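(* Let $R=\mathbb{C}[x_1,\dots,x_N]$ be graded by a finitely generated abelian group $M$ via $\deg(x_i)=d_i\in M$, with $\dim_{\mathbb{C}}(R_0)=1$. Let $I,J\subseteq R$ be $M$-graded ideals, $g\in R$ an $M$-homogeneous polynomial, and $m\in M$. Suppose that $J=\langle g_1,\dots,g_t\rangle$ where each $g_i$ is $M$-homogeneous. Then: 1. $\Phi_g\bigl(D_0^{m+\deg g}(I)\bigr)=\Phi_g\bigl(D_0^{m+\deg g}(I\cap\langle g\rangle)\bigr)=D_0^m(I:g)$. 2. $\sum_{i=1}^t\Phi_{g_i}\bigl(D_0^{m+\deg g_i}(I)\bigr)=\sum_{i=1}^t D_0^m(I:g_i)=D_0^m(I:J)$.
   Context: Grading: given $d_1,\dots,d_N\in M$, set $\deg(x^\alpha)=\sum_{i=1}^N\alpha_i d_i\in M$ for $\alpha\in(\mathbb{Z}_{\ge 0})^N$, and for $m\in M$ let $R_m=\mathrm{span}_{\mathbb{C}}\{x^\alpha : \deg(x^\alpha)=m\}$, so $R=\bigoplus_{m\in M}R_m$. A polynomial $g\in R_m$ is called $M$-homogeneous of degree $\deg g=m$. An ideal is $M$-graded if it is generated by $M$-homogeneous polynomials. Standing assumption: $\dim_{\mathbb{C}}(R_0)=1$, i.e. $R_0=\mathbb{C}$ (equivalently $\dim_{\mathbb{C}} R_m<\infty$ for all $m\in M$). Dual spaces: for $\alpha\in(\mathbb{Z}_{\ge 0})^N$ let $\partial_\alpha:R\to\mathbb{C}$ be the linear functional $\partial_\alpha(g)=\frac{1}{\alpha!}\frac{\partial^{|\alpha|}g}{\partial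 x_1^{\alpha_1}\cdots\partial x_N^{\alpha_N}}\Big|_{x=0}$, where $\alpha!=\prod_i\alpha_i!$ and $|\alpha|=\sum_i\alpha_i$ (i.e. the coefficient of $x^\alpha$ in $g$). Let $D_0=\mathrm{span}_{\mathbb{C}}\{\partial_\alpha:\alpha\in(\mathbb{Z}_{\ge 0})^N\}$ (finite linear combinations), and $D_0^m=\mathrm{span}_{\mathbb{C}}\{\partial_\alpha:\deg(x^\alpha)=m\}$ for $m\in M$. For an ideal $I$, $D_0(I)=\{\partial\in D_0:\partial(f)=0\text{ for all }f\in I\}$ and $D_0^m(I)=D_0^m\cap D_0(I)$. For $M$-homogeneous $g$, the linear operator $\Phi_g:D_0\to D_0$ is defined by $\Phi_g(\partial)(f)=\partial(gf)$ for all $f\in R$; equivalently $\Phi_g(\partial_\alpha)=\sum_{\gamma:\ \deg(x^\gamma)=\deg g}\partial_\gamma(g)\,\partial_{\alpha-\gamma}$, with $\partial_{\alpha-\gamma}=0$ if $\alpha-\gamma\notin(\mathbb{Z}_{\ge 0})^N$. Quotients: $I:J=\{f\in R: f\cdot J\subseteq I\}$ and $I:g=\{f\in R: fg\in I\}$. *)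

(* Defs.v *)
From HB Require Import structures.
From mathcomp Require Import all_boot all_order all_algebra complex.
(* [mpoly] must be imported before the classical layer: in the other order
   their notations clash. *)
From mathcomp Require Import mpoly.
From mathcomp Require Import boolp classical_sets functions reals.

Set Implicit Arguments.
Unset Strict Implicit.
Unset Printing Implicit Defensive.

Import Order.TTheory GRing.Theory Num.Theory.
Local Open Scope classical_set_scope.
Local Open Scope ring_scope.

Definition finitely_generated (M : zmodType) : Prop :=
  exists (n : nat) (s : 'I_n -> M),
    forall m : M, exists c : 'I_n -> int, m = \sum_(i < n) s i *~ c i.

Definition span (K : fieldType) (V : lmodType K) (S : set V) : set V :=
  [set v | exists (n : nat) (c : 'I_n -> K) (w : 'I_n -> V),
     (forall i, S (w i)) /\ v = \sum_(i < n) c i *: w i].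

Definition lin_indep (K : fieldType) (V : lmodType K) (n : nat)
    (b : 'I_n -> V) : Prop :=
  forall c : 'I_n -> K, \sum_(i < n) c i *: b i = 0 -> forall i, c i = 0.

Definition has_dim (K : fieldType) (V : lmodType K) (U : set V) (n : nat) :
    Prop :=
  exists b : 'I_n -> V, lin_indep b /\ span (range b) = U.

(* The sum of a finite family of subspaces; for t = 0 it is {0}. *)
Definition sum_sub (V : zmodType) (t : nat) (U : 'I_t -> set V) : set V :=
  [set v | exists2 u : 'I_t -> V, forall i, U i (u i) & v = \sum_(i < t) u i].

Section Ideals.
Variable A : comNzRingType.
Implicit Types (I J S : set A) (f g : A).

(* The whole ring is allowed, unlike with the library's [idealr_closed]:
   I : g is the unit ideal as soon as g lies in I. *)
Definition is_ideal I : Prop :=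
  [/\ I 0, forall f g, I f -> I g -> I (f + g) & forall a f, I f -> I (a * f)].

Definition ideal_gen S : set A := smallest is_ideal S.

Definition colon I J : set A := [set f | forall h, J h -> I (f * h)].

Definition colon1 I g : set A := [set f | I (f * g)].

End Ideals.

Section Grading.
Variables (K : fieldType) (M : zmodType) (N : nat) (d : 'I_N -> M).
Implicit Types (m : M) (a : 'X_{1..N}).

Definition wdeg a : M := \sum_(i < N) d i *+ a i.

Definition Rdeg m : set {mpoly K[N]} :=
  span [set 'X_[K, a] | a in [set a | wdeg a = m]].

Definition is_graded_ideal (I : set {mpoly K[N]}) : Prop :=
  exists S : set {mpoly K[N]},
    (forall f, S f -> exists m, Rdeg m f) /\ I = ideal_gen S.

End Grading.

Arguments Rdeg K {M N} d m.

Section Dual.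
Variables (K : fieldType) (N : nat).
Implicit Types (a : 'X_{1..N}) (f g : {mpoly K[N]}) (I : set {mpoly K[N]}).

(* Ambient space of all maps R -> K; the dual spaces below are subspaces. *)
Definition functional : lmodType K := {mpoly K[N]} -> K^o.

Definition partial a : functional :=
  fun g => ((\prod_(i < N) (a i)`!)%:R)^-1 * (g^`M[a]).@[fun=> 0].

Definition D0 : set functional := span (range partial).

Definition D0I I : set functional :=
  D0 `&` [set D | forall f, I f -> D f = 0].

Definition Phi g (D : functional) : functional := fun f => D (g * f).

End Dual.

Section GradedDual.
Variables (K : fieldType) (M : zmodType) (N : nat) (d : 'I_N -> M).

Definition D0deg (m : M) : set (functional K N) :=
  span [set partial a | a in [set a | wdeg d a = m]].

Definition D0degI (m : M) (I : set {mpoly K[N]}) : set (functional K N) :=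
  D0deg m `&` D0I I.

End GradedDual.

Lemma partialE (K : numFieldType) (N : nat) (a : 'X_{1..N})
    (g : {mpoly K[N]}) : partial a g = g@_a.
Proof.
have ev0 (p : {mpoly K[N]}) : p.@[fun=> 0] = p@_0%MM.
  rewrite (mpolyE p) !raddf_sum /=; apply: eq_bigr => b _.
  rewrite mevalZ mcoeffZ mevalX mcoeffX; congr (_ * _).
  have [->|bn0] := eqVneq b 0%MM.
    by rewrite big1 // => i _; rewrite mnm0E expr0.
  have [i bi] : exists i, b i != 0%N.
    apply/existsP; apply: contraNT bn0 => /existsPn b0.
    by apply/eqP/mnmP => i; rewrite mnm0E; apply/eqP/negPn/b0.
  by rewrite (bigD1 i) //= expr0n (negbTE bi) mul0r.
rewrite /partial ev0 mcoeff_mderivm addm0.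
have -> : (\prod_(i < N) (a i) ^_ (a i))%N = (\prod_(i < N) (a i)`!)%N.
  by apply: eq_bigr => i _; rewrite ffactnn.
rewrite -[X in _ * X]mulr_natl mulrA mulVf ?mul1r // pnatr_eq0 -lt0n.
by rewrite prodn_gt0 // => i; exact: fact_gt0.
Qed.

Lemma Phi_partial (K : numFieldType) (N : nat) (g : {mpoly K[N]})
    (a : 'X_{1..N}) :
  Phi g (partial a) =
  \sum_(c <- msupp g | (c <= a)%MM) g@_c *: partial (a - c)%MM.
Proof.
apply/funext => f; rewrite /Phi partialE {1}(mpolyE g) mulr_suml raddf_sum /=.
rewrite fct_sumE [RHS]big_mkcond /=; apply: eq_bigr => c _.
rewrite -scalerAl mcoeffZ; case: ifPn => ca.
  transitivity (g@_c * f@_(a - c)%MM); last by rewrite -(partialE _ f).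
  by rewrite -(mcoeffMX f c) addmC submK // ['X_[c] * f]mulrC.
rewrite (mpolyE f) mulr_sumr raddf_sum /= big1 ?mulr0 // => b _.
rewrite -scalerAr -mpolyXD mcoeffZ mcoeffX.
case: eqP => [cb|_]; last by rewrite mulr0.
by move: ca; rewrite -cb lem_addr.
Qed.

(* Main.v *)
(* A monomial of degree 0 is 1, so by Dickson's lemma every R_m is
   finite-dimensional and D_0^m is its full dual.  Everything then reduces to
   one extension statement: a functional D on R_m vanishing on (I : J)_m
   factors through the injection f |-> (f * g_i)_i of R_m / (I : J)_m into the
   direct sum of the R_(m + deg g_i) / I, hence extends to that sum, and the components of
   the extension are D'_i in D_0^(m + deg g_i)(I) with
   D = sum_i Phi_(g_i)(D'_i).  Part 1 is the case J = <g>. *)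

Require Import Defs.
From HB Require Import structures.
From mathcomp Require Import all_boot all_order all_algebra complex.
From mathcomp Require Import mpoly.
From mathcomp Require Import boolp classical_sets functions reals.
From mathcomp Require Import cardinality.

Import Order.TTheory GRing.Theory Num.Theory.
Local Open Scope classical_set_scope.
Local Open Scope ring_scope.

Set Implicit Arguments.
Unset Strict Implicit.

(** * Dickson's lemma for monomials *)

(** Each chosen index minimises [u] on a tail that starts just after the previous choice, so every
    later choice has a value at least as large. *)
Lemma nondecreasing_subseq (u : nat -> nat) :
  exists2 p : nat -> nat, {homo p : i j / (i < j)%N}
    & {homo u \o p : i j / (i <= j)%N}.
Proof.
have tail_min n : exists2 k, (n <= k)%N & forall i, (n <= i)%N -> (u k <= u i)%N.
  have [|v /asboolP[k nk <-] vmin] :=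
      @ex_minnP (fun v => `[< exists2 k, (n <= k)%N & u k = v >]).
    by exists (u n); apply/asboolP; exists n.
  by exists k => // i ni; apply: vmin; apply/asboolP; exists i.
pose next n := projT1 (cid2 (tail_min n)).
have next_ge n : (n <= next n)%N by rewrite /next; case: cid2.
have next_min n i : (n <= i)%N -> (u (next n) <= u i)%N.
  by rewrite /next; case: cid2 => k /= _; apply.
pose p := fix p i := if i is i'.+1 then next (p i').+1 else next 0%N.
have p_incr i : (p i < p i.+1)%N by rewrite [p i.+1]/= next_ge.
exists p; first by apply: (homo_ltn ltn_trans).
apply: (homo_leq leqnn leq_trans) => -[|i].
  by apply: next_min.
by apply: next_min; rewrite (leq_trans (p_incr _)) // ltnW.
Qed.

(* Dickson's lemma *)
Lemma mnm_seq_good (n : nat) (u : nat -> 'X_{1..n}) :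
  exists i j, (i < j)%N /\ (u i <= u j)%MM.
Proof.
suff [p p_incr p_mono] : exists2 p : nat -> nat, {homo p : i j / (i < j)%N}
    & forall k, k \in enum 'I_n -> {homo (fun i => u (p i) k) : i j / (i <= j)%N}.
  exists (p 0%N), (p 1%N); split; first exact: p_incr.
  by apply/mnm_lepP => k; apply: p_mono; rewrite ?mem_enum.
(* One coordinate at a time: a further subsequence keeps the earlier coordinates nondecreasing. *)
elim: (enum 'I_n) => [|k l [p p_incr p_mono]]; first by exists id.
have [q q_incr q_mono] := nondecreasing_subseq (fun i => u (p i) k).
exists (p \o q) => [i j ij|k']; first exact/p_incr/q_incr.
rewrite inE => /predU1P[->|/p_mono p_k'] i j ij; first exact: q_mono.
by apply: p_k'; apply: (ltnW_homo q_incr).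
Qed.

(** * Linear algebra in coordinates *)

Lemma linear_bundle (K : fieldType) (U V : lmodType K) (F : U -> V) :
  linear F -> exists L : {linear U -> V}, F = L.
Proof.
move=> F_lin.
pose F_isLinear := GRing.isLinear.Build K U V *:%R F F_lin.
pose L : {linear U -> V} := HB.pack F F_isLinear.
by exists L.
Qed.

Lemma linear_mxP (K : fieldType) (p q : nat) (F : 'rV[K]_p -> 'rV[K]_q) :
  linear F -> exists A : 'M_(p, q), forall u, F u = u *m A.
Proof.
by case/linear_bundle => L ->; exists (lin1_mx L) => u; rewrite mul_rV_lin1.
Qed.

(** Among the matrices with row space inside [U], take one of maximal rank: a vector of [U] outside
    its row space could be adjoined and would raise the rank. *)
Lemma subspace_mxP (K : fieldType) (n : nat) (U : set 'rV[K]_n) :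
  U 0 -> (forall a u v, U u -> U v -> U (a *: u + v)) ->
  exists A : 'M_n, forall v, U v <-> (v <= A)%MS.
Proof.
move=> U0 U_lin.
pose spanned r := `[< exists2 A : 'M_n,
  forall v : 'rV_n, (v <= A)%MS -> U v & \rank A = r >].
have [||r /asboolP[A AU rA] r_max] := @ex_maxnP spanned n.
- exists 0%N; apply/asboolP; exists 0; last exact: mxrank0.
  by move=> v; rewrite submx0 => /eqP ->.
- by move=> r /asboolP[A _ <-]; exact: rank_leq_row.
exists A => v; split=> [Uv|/AU//]; apply: contraT => vA.
suff /r_max : spanned (\rank (A + v)%MS).
  rewrite -rA leqNgt => /negP[].
  have := ltmxErank A (A + v)%MS; rewrite addsmxSl /= => <-.
  by rewrite /ltmx addsmxSl addsmx_sub submx_refl.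
apply/asboolP; exists (A + v)%MS => // w /sub_addsmxP[[x y] /= ->].
by rewrite addrC [y]mx11_scalar mul_scalar_mx; apply/U_lin/AU/submxMl.
Qed.

(** Double annihilator: the span of the columns of all [B i] consists of the functionals that vanish
    on the common left kernel of the [B i]. *)
Lemma common_ker_dual (K : fieldType) (p t : nat) (q : 'I_t -> nat)
    (B : forall i, 'M[K]_(p, q i)) (c : 'cV[K]_p) :
  (forall x : 'rV_p, (forall i, x *m B i = 0) -> x *m c = 0) ->
  exists z : forall i, 'cV[K]_(q i), c = \sum_i B i *m z i.
Proof.
move=> kerBc.
(* [<<_>>] makes square matrices of the transposes, whose numbers of rows vary with [i], so that
   their row spaces can be summed. *)
have : (c^T <= \sum_i <<(B i)^T>>)%MS.
  (* Each column of [Y], transposed, is a row vector killed by every [B i], so [kerBc] applies to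
     it. *)
  rewrite submxE; set Y := cokermx _.
  apply/eqP/trmx_inj/row_matrixP => k.
  rewrite trmx_mul trmxK trmx0 row_mul row0; apply: kerBc => i.
  suff YB0 : Y^T *m B i = 0 by rewrite -row_mul YB0 row0.
  apply/trmx_inj; rewrite trmx_mul trmxK trmx0; apply/eqP.
  by rewrite -submxE (sumsmx_sup i) // genmxE.
case/sub_sumsmxP => u cE.
have /(_ _)/submxP/cid z i : (u i *m <<(B i)^T>> <= (B i)^T)%MS.
  by rewrite (submx_trans (submxMl _ _)) // genmxE.
exists (fun i => (projT1 (z i))^T); rewrite -[c]trmxK cE raddf_sum /=.
by apply: eq_bigr => i _; case: (z i) => w /= ->; rewrite trmx_mul trmxK.
Qed.

(** * Finiteness of the graded pieces *)

Section Finiteness.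
Variables (K : fieldType) (M : zmodType) (N : nat) (d : 'I_N -> M).

Lemma wdegD (a b : 'X_{1..N}) : wdeg d (a + b)%MM = wdeg d a + wdeg d b.
Proof.
by rewrite -big_split; apply: eq_bigr => i _; rewrite mnmDE mulrnDr.
Qed.

Lemma wdeg0 : wdeg d 0%MM = 0.
Proof. by apply: big1 => i _; rewrite mnm0E mulr0n. Qed.

Lemma span_sub (V : lmodType K) (S : set V) : S `<=` Defs.span S.
Proof.
move=> v Sv; exists 1%N, (fun=> 1), (fun=> v); split=> //.
by rewrite big_ord1 scale1r.
Qed.

(** Otherwise the independent polynomials ['X_[a]] and 1 would both lie on the line [R_0]. *)
Lemma wdeg_eq0 (a : 'X_{1..N}) :
  has_dim (Rdeg K d 0) 1 -> wdeg d a = 0 -> a = 0%MM.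
Proof.
move=> [b [_ b_span]] a0.
have line c : wdeg d c = 0 -> exists k : K, 'X_[c] = k *: b ord0.
  move=> c0; have : Defs.span (range b) 'X_[K, c].
    by rewrite b_span; apply: span_sub; exists c.
  move=> [n [k [w [wb ->]]]]; exists (\sum_(i < n) k i).
  rewrite scaler_suml; apply: eq_bigr => i _.
  by have [j _ <-] := wb i; rewrite ord1.
have [k Xk] := line _ a0; have [l Xl] := line _ wdeg0.
have l_neq0 : l != 0.
  apply/eqP => l0; move/eqP: Xl; rewrite l0 scale0r mpolyX0.
  by rewrite oner_eq0.
have : ('X_[K, a])@_a = (k / l *: 'X_[0])@_a.
  by rewrite Xk Xl scalerA divfK.
rewrite mcoeffZ !mcoeffX eqxx; have [->//|_] := eqVneq.
by rewrite mulr0 => /eqP; rewrite oner_eq0.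
Qed.

(** In an infinite sequence of distinct monomials of degree [k], one divides a later one; the
    quotient has degree 0, hence is 1, and the two coincide. *)
Lemma finite_wdeg (k : M) :
  has_dim (Rdeg K d 0) 1 -> finite_set [set a | wdeg d a = k].
Proof.
move=> R0_line; apply: contrapT => /infiniteP/card_leP[f].
pose u i := val (f (exist _ i (mem_set (I : [set: nat] i)))).
have u_wdeg i : wdeg d (u i) = k.
  by rewrite /u; case: (f _) => a /= /set_mem.
have [i [j [ij uij]]] := mnm_seq_good u.
have : wdeg d (u j - u i)%MM + wdeg d (u i) = wdeg d (u i).
  by rewrite -wdegD submK // !u_wdeg.
move=> /(canRL (addrK _)); rewrite subrr => /(wdeg_eq0 R0_line) u_eq.
have /val_inj : u i = u j by rewrite -(submK uij) u_eq add0m.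
move=> /(@inj _ _ _ f); rewrite !in_setT => /(_ isT isT) [].
by move=> /eqP; rewrite ltn_eqF.
Qed.

(** The lists [s k] serve as monomial bases, identifying [R_k] with row vectors of length
    [size (s k)]. *)
Lemma wdeg_enum : has_dim (Rdeg K d 0) 1 ->
  exists s : M -> seq 'X_{1..N},
    (forall k, uniq (s k)) /\ forall k a, (a \in s k) = (wdeg d a == k).
Proof.
move=> R0_line.
have /(_ _)/finite_seqP/cid s k := finite_wdeg k R0_line.
exists (fun k => undup (projT1 (s k))); split=> [k|k a].
  exact: undup_uniq.
rewrite mem_undup; case: (s k) => l /= kl.
apply/idP/eqP => [al|ak]; last first.
  by have : [set a | wdeg d a = k] a by []; rewrite kl.
by have : [set` l] a by []; rewrite -kl.
Qed.

End Finiteness.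

(** * Coordinates and homogeneous components *)

Section GradedPieces.
Variables (K : numFieldType) (M : zmodType) (N : nat) (d : 'I_N -> M).
Variable s : M -> seq 'X_{1..N}.
Hypothesis s_uniq : forall k, uniq (s k).
Hypothesis mem_s : forall k a, (a \in s k) = (wdeg d a == k).

Definition mon (k : M) (j : 'I_(size (s k))) : 'X_{1..N} :=
  tnth (in_tuple (s k)) j.
Arguments mon : clear implicits.

Definition coords (k : M) (f : {mpoly K[N]}) : 'rV[K]_(size (s k)) :=
  \row_j f@_(mon k j).

Definition of_coords (k : M) (v : 'rV[K]_(size (s k))) : {mpoly K[N]} :=
  \sum_j v 0 j *: 'X_[mon k j].
Arguments of_coords : clear implicits.

Definition hcomp (k : M) (f : {mpoly K[N]}) : {mpoly K[N]} :=
  of_coords k (coords k f).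

Lemma wdeg_mon (k : M) (j : 'I_(size (s k))) : wdeg d (mon k j) = k.
Proof. by apply/eqP; rewrite -mem_s mem_tnth. Qed.

Lemma mon_inj (k : M) : injective (mon k).
Proof. by move=> i j /(tuple_uniqP (in_tuple (s k)) (s_uniq k)). Qed.

Lemma mon_surj (k : M) (a : 'X_{1..N}) :
  wdeg d a = k -> exists j, mon k j = a.
Proof.
move=> ak; have /tnthP[j aE] : a \in in_tuple (s k) by rewrite mem_s ak.
by exists j; exact: esym aE.
Qed.

Lemma coords_linear (k : M) : linear (coords k).
Proof. by move=> c f h; apply/rowP => j; rewrite !mxE mcoeffD mcoeffZ. Qed.

Lemma of_coords_linear (k : M) : linear (of_coords k).
Proof.
move=> c u v; rewrite /of_coords scaler_sumr -big_split; apply: eq_bigr => j _.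
by rewrite !mxE scalerDl scalerA.
Qed.

Lemma hcomp_linear (k : M) : linear (hcomp k).
Proof. by move=> c f h; rewrite /hcomp coords_linear of_coords_linear. Qed.

Lemma of_coordsK (k : M) : cancel (of_coords k) (coords k).
Proof.
move=> v; apply/rowP => j; rewrite mxE raddf_sum (bigD1 j) //=.
rewrite mcoeffZ mcoeffX eqxx mulr1 big1 ?addr0 // => i ij.
by rewrite mcoeffZ mcoeffX (inj_eq (@mon_inj _)) (negbTE ij) mulr0.
Qed.

Lemma mcoeff_hcomp (k : M) (f : {mpoly K[N]}) (a : 'X_{1..N}) :
  (hcomp k f)@_a = if wdeg d a == k then f@_a else 0.
Proof.
case: eqP => [/mon_surj[j <-]|ak].
  by have /rowP/(_ j) := of_coordsK (coords k f); rewrite !mxE.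
rewrite raddf_sum /=; apply: big1 => j _ /=; rewrite mcoeffZ mcoeffX.
by case: eqP => [ja|]; [case: ak; rewrite -ja wdeg_mon|rewrite mulr0].
Qed.

(** Multiplication by a monomial shifts degrees. Since [M] is a group, [k - wdeg d b] makes sense
    even when no monomial has that degree. *)
Lemma hcompXM (k : M) (b : 'X_{1..N}) (f : {mpoly K[N]}) :
  hcomp k ('X_[b] * f) = 'X_[b] * hcomp (k - wdeg d b) f.
Proof.
apply/mpolyP => a; rewrite mcoeff_hcomp.
have [ba|ba] := boolP (b <= a)%MM; last first.
  have bM0 h : ('X_[b] * h)@_a = 0 :> K.
    apply: memN_msupp_eq0; rewrite mulrC (perm_mem (msuppMX _ _)).
    apply: contra ba.
    by case/mapP => c _ ->; rewrite lem_addr.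
  by rewrite !bM0 if_same.
have bM h : ('X_[b] * h)@_a = h@_(a - b) :> K.
  by rewrite -{1}(submK ba) addmC mulrC mcoeffMX.
by rewrite !bM mcoeff_hcomp -(submK ba) wdegD addmK eq_sym -subr_eq eq_sym.
Qed.

Lemma hcomp_id (k : M) (f : {mpoly K[N]}) : Rdeg K d k f -> hcomp k f = f.
Proof.
case/linear_bundle: (hcomp_linear k) => L LE.
move=> [n [c [w [w_deg ->]]]]; rewrite LE raddf_sum /=.
apply: eq_bigr => i _; rewrite linearZ -LE; have [a ak <-] := w_deg i.
congr (_ *: _); apply/mpolyP => b; rewrite mcoeff_hcomp mcoeffX.
by case: eqP => // bk; case: eqP => // ab; case: bk; rewrite -ab.
Qed.

Lemma hcomp_homogM (k e : M) (g f : {mpoly K[N]}) : Rdeg K d e g ->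
  hcomp (k + e) (f * g) = hcomp k f * g.
Proof.
case/linear_bundle: (hcomp_linear (k + e)) => L LE.
move=> [n [c [w [w_deg ->]]]]; rewrite !mulr_sumr LE raddf_sum /=.
apply: eq_bigr => i _; rewrite -!scalerAr linearZ -LE; congr (_ *: _).
by have [a <- <-] := w_deg i; rewrite ![_ * 'X_[_]]mulrC hcompXM addrK.
Qed.

Lemma ideal_sum (I : set {mpoly K[N]}) (T : Type) (r : seq T)
    (F : T -> {mpoly K[N]}) :
  is_ideal I -> (forall i, I (F i)) -> I (\sum_(i <- r) F i).
Proof. by move=> [I0 ID _] IF; elim/big_ind: _. Qed.

Lemma ideal_scale (I : set {mpoly K[N]}) (c : K) (f : {mpoly K[N]}) :
  is_ideal I -> I f -> I (c *: f).
Proof. by move=> [_ _ IM] If; rewrite -mul_mpolyC; apply: IM. Qed.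

Lemma ideal_gen_ideal (S : set {mpoly K[N]}) : is_ideal (ideal_gen S).
Proof.
split=> [I' [[I0 _ _] _] //|f h If Ih I' SI'|a f If I' SI'].
  by have [[_ ID _] _] := SI'; apply: ID; [exact: If|exact: Ih].
by have [[_ _ IM] _] := SI'; apply: IM; exact: If.
Qed.

(** The polynomials with all components in the ideal form an ideal [U] containing the homogeneous
    generators. *)
Lemma graded_hcomp (I : set {mpoly K[N]}) (k : M) (f : {mpoly K[N]}) :
  is_graded_ideal d I -> I f -> I (hcomp k f).
Proof.
move=> [S [S_homog ->]] f_gen.
have I_ideal := ideal_gen_ideal S; have [I0 ID IM] := I_ideal.
(* All degrees are quantified at once because multiplication by a monomial carries one component to
   another degree. *)
pose U := [set h | forall k, ideal_gen S (hcomp k h)].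
suff : ideal_gen S `<=` U by move=> /(_ f f_gen); apply.
apply: smallest_sub => {k f f_gen} [|f Sf k].
  split=> [k|f h If Ih k|a f If k].
  - by case/linear_bundle: (hcomp_linear k) => L ->; rewrite linear0.
  - by rewrite -[f]scale1r hcomp_linear scale1r; apply: ID.
  rewrite (mpolyE a) mulr_suml.
  case/linear_bundle: (hcomp_linear k) => L LE; rewrite LE raddf_sum /=.
  apply: (ideal_sum _ I_ideal) => b; rewrite -scalerAl linearZ -LE hcompXM.
  by apply: (ideal_scale _ I_ideal); apply: IM; exact: If.
have [e fe] := S_homog f Sf.
suff -> : hcomp k f = if k == e then f else 0.
  by case: ifP => // _; exact: sub_gen_smallest.
apply/mpolyP => a; rewrite mcoeff_hcomp -(hcomp_id fe) (fun_if (mcoeff a)).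
rewrite mcoeff0 mcoeff_hcomp; case: (wdeg d a =P k) => [->|ak].
  by case: eqP.
by case: eqP => // <-; case: eqP.
Qed.

(** * Graded dual spaces and the extension statement *)

(** A linear functional that sees only the degree [k] component is determined by its values on the
    finitely many monomials in [s k]; these values are its coefficients on the [partial a]. *)
Lemma D0degP (k : M) (D : functional K N) :
  D0deg d k D <-> linear D /\ forall f, D f = D (hcomp k f).
Proof.
split=> [[n [c [w [w_deg ->]]]]|[D_lin Dk]].
  rewrite fct_sumE; split=> [b f h|f].
    rewrite scaler_sumr -big_split; apply: eq_bigr => i _.
    rewrite /=; have [a _ <-] := w_deg i; rewrite !fctE !partialE.
    by rewrite mcoeffD mcoeffZ scalerDr; congr (_ + _); exact: mulrCA.
  apply: eq_bigr => i _; have [a /= <- <-] := w_deg i.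
  by rewrite !fctE !partialE mcoeff_hcomp eqxx.
exists (size (s k)), (fun j => D 'X_[mon k j]), (fun j => partial (mon k j)).
split=> [j|]; first by exists (mon k j) => //=; exact: wdeg_mon.
apply/funext => f; rewrite Dk fct_sumE.
case/linear_bundle: D_lin => L ->; rewrite raddf_sum /=; apply: eq_bigr => j _.
by rewrite linearZ fctE partialE mxE /= /GRing.scale /= mulrC.
Qed.

Lemma D0deg_D0 (k : M) : D0deg d k `<=` @D0 K N.
Proof.
move=> D [n [c [w [w_deg ->]]]]; exists n, c, w; split=> // i.
by have [a _ <-] := w_deg i; exists a.
Qed.

Lemma D0degI_sum (k : M) (A : set {mpoly K[N]}) (t : nat)
    (u : 'I_t -> functional K N) :
  (forall i, D0degI d k A (u i)) -> D0degI d k A (\sum_i u i).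
Proof.
move=> uA; have u_deg : D0deg d k (\sum_i u i).
  apply/D0degP; rewrite fct_sumE; split=> [c f h|f].
    rewrite scaler_sumr -big_split; apply: eq_bigr => i _.
    by have [/D0degP[u_lin _] _] := uA i; exact: u_lin.
  by apply: eq_bigr => i _; have [/D0degP[_ u_k] _] := uA i; exact: u_k.
split=> //; split=> [|f Af]; first exact: D0deg_D0 u_deg.
by rewrite fct_sumE big1 // => i _; have [_ [_ ->]] := uA i.
Qed.

Lemma D0deg_Phi (k e : M) (g : {mpoly K[N]}) (D : functional K N) :
  Rdeg K d e g -> D0deg d (k + e) D -> D0deg d k (Phi g D).
Proof.
move=> ge /D0degP[D_lin De]; apply/D0degP; split=> [c f h|f].
  by rewrite /Phi mulrDr -scalerAr D_lin.
by rewrite /Phi De ![g * _]mulrC hcomp_homogM.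
Qed.

Lemma Phi_lift (I : set {mpoly K[N]}) (m : M) (t : nat)
    (gs : 'I_t -> {mpoly K[N]}) (es : 'I_t -> M) (D : functional K N) :
  is_graded_ideal d I -> (forall i, Rdeg K d (es i) (gs i)) ->
  D0deg d m D -> (forall f, (forall i, I (f * gs i)) -> D f = 0) ->
  exists D' : 'I_t -> functional K N,
    (forall i, D0degI d (m + es i) I (D' i)) /\ D = \sum_i Phi (gs i) (D' i).
Proof.
move=> I_graded gs_homog /D0degP[D_lin Dm] D_vanish.
have I_ideal : is_ideal I by case: I_graded => S [_ ->]; exact: ideal_gen_ideal.
have [I0 ID IM] := I_ideal.
pose q i := size (s (m + es i)).
have /(_ _)/linear_mxP/cid T i :
    linear (fun v => coords (m + es i) (of_coords m v * gs i)).
  by move=> c u v; rewrite of_coords_linear mulrDl -scalerAl coords_linear.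
(* The row space of [A i] is the degree [m + es i] piece of [I], and [T i] is multiplication by
   [gs i]. *)
have /(_ _)/cid A i : exists A : 'M_(q i), forall v,
    I (of_coords (m + es i) v) <-> (v <= A)%MS.
  apply: subspace_mxP => [|c u v Iu Iv].
    by case/linear_bundle: (@of_coords_linear (m + es i)) => L ->; rewrite linear0.
  by rewrite of_coords_linear; apply: ID => //; apply: ideal_scale.
pose c : 'cV_(size (s m)) := \col_j D 'X_[mon m j].
have D_coords f : D f = (coords m f *m c) 0 0.
  rewrite Dm mxE; case/linear_bundle: D_lin => L DE.
  rewrite /c DE raddf_sum /=; apply: eq_bigr => j _.
  by rewrite linearZ !mxE.
(* Right multiplication by [C i] is reduction modulo [I] in degree [m + es i], so the kernel of
   [T i] followed by [C i] is the degree [m] piece of [I : gs i]. *)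
pose C i := cokermx (projT1 (A i)).
have [x x_ker|z cE] :=
    @common_ker_dual _ _ _ _ (fun i => projT1 (T i) *m C i) c.
  suff Df0 : D (of_coords m x) = 0.
    by rewrite [x *m c]mx11_scalar -{1}[x]of_coordsK -D_coords Df0 raddf0.
  apply: D_vanish => i.
  have <- : hcomp (m + es i) (of_coords m x * gs i) = of_coords m x * gs i.
    by rewrite (hcomp_homogM _ _ (gs_homog i)) /hcomp of_coordsK.
  apply/(projT2 (A i)); rewrite /= (projT2 (T i)) submxE -mulmxA.
  exact/eqP/x_ker.
(* Passing through [C i] is what makes [D' i] vanish on [I]. *)
pose D' i : functional K N :=
  fun f => (coords (m + es i) f *m (C i *m z i)) 0 0.
exists D'; split=> [i|].
  have D'_deg : D0deg d (m + es i) (D' i).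
    apply/D0degP; split=> [a f h|f]; last by rewrite /D' /hcomp of_coordsK.
    by rewrite /D' coords_linear mulmxDl -scalemxAl !mxE.
  split=> //; split; first exact: D0deg_D0 D'_deg.
  (* Gradedness of [I] enters here: [f] may be inhomogeneous, but its component of degree [m + es i]
     is again in [I]. *)
  move=> f /(graded_hcomp (m + es i) I_graded)/(projT2 (A i)).
  rewrite submxE -/(C i) => /eqP fC0.
  by rewrite /D' (mulmxA _ (C i)) fC0 mul0mx mxE.
apply/funext => f; rewrite fct_sumE D_coords cE mulmx_sumr summxE.
apply: eq_bigr => i _; rewrite /Phi /D' -(mulmxA (projT1 (T i))).
rewrite (mulmxA _ (projT1 (T i))) -(projT2 (T i)) [gs i * f]mulrC.
by rewrite -/(hcomp m f) -(hcomp_homogM _ _ (gs_homog i)) /hcomp of_coordsK.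
Qed.

End GradedPieces.

(** * Colon ideals and the two chains of equalities *)

Section Colon.
Variables (K : fieldType) (N : nat).

Lemma D0I_sub (A B : set {mpoly K[N]}) : A `<=` B -> D0I B `<=` D0I A.
Proof. by move=> AB D [D0D DB]; split=> // f /AB; apply: DB. Qed.

(** For fixed [f], the [h] with [f * h] in [I] form an ideal, so testing the generators suffices. *)
Lemma colon_gen (I : set {mpoly K[N]}) (t : nat) (gs : 'I_t -> {mpoly K[N]}) :
  is_ideal I ->
  colon I (ideal_gen (range gs)) = [set f | forall i, colon1 I (gs i) f].
Proof.
move=> [I0 ID IM]; apply/seteqP; split=> f /= If.
  by move=> i; apply: If; apply: sub_gen_smallest; exists i.
apply: smallest_sub => [|_ [i _ <-]]; last exact: If.
split=> [|h k|a h]; first by rewrite mulr0.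
  by rewrite mulrDr; exact: ID.
by rewrite mulrCA; exact: IM.
Qed.

End Colon.

Unset Implicit Arguments.
Set Strict Implicit.

Theorem theorem4p8 (R : realType) (M : zmodType) (hM : finitely_generated M)
  (N : nat) (d : 'I_N -> M)
  (hR0 : has_dim (Rdeg R[i] d 0) 1)
  (I J : set {mpoly R[i][N]})
  (hI : is_graded_ideal d I) (hJ : is_graded_ideal d J)
  (g : {mpoly R[i][N]}) (e : M) (hg : Rdeg R[i] d e g)
  (m : M)
  (t : nat) (gs : 'I_t -> {mpoly R[i][N]}) (es : 'I_t -> M)
  (hgs : forall i, Rdeg R[i] d (es i) (gs i))
  (hJgs : J = ideal_gen (range gs)) :
  [/\ Phi g @` D0degI d (m + e) I
        = Phi g @` D0degI d (m + e) (I `&` ideal_gen [set g]),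
      Phi g @` D0degI d (m + e) (I `&` ideal_gen [set g])
        = D0degI d m (colon1 I g),
      sum_sub (fun i => Phi (gs i) @` D0degI d (m + es i) I)
        = sum_sub (fun i => D0degI d m (colon1 I (gs i)))
    & sum_sub (fun i => D0degI d m (colon1 I (gs i)))
        = D0degI d m (colon I J)].
Proof.
have [s [s_uniq mem_s]] := wdeg_enum hR0.
have I_ideal : is_ideal I.
  by case: hI => S [_ ->]; exact: ideal_gen_ideal.
(* If [f] lies in [I : h], then [h * f] lies in both [I] and the ideal of [h], so vanishing on the
   intersection is enough. *)
have Phi_colon (h : {mpoly R[i][N]}) (k : M) (D : functional R[i] N) :
    Rdeg R[i] d k h -> D0degI d (m + k) (I `&` ideal_gen [set h]) D ->
    D0degI d m (colon1 I h) (Phi h D).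
  move=> hk [D_deg [_ D_vanish]].
  have PhiD_deg := D0deg_Phi s_uniq mem_s hk D_deg.
  split=> //; split=> [|f If]; first exact: D0deg_D0 PhiD_deg.
  apply: D_vanish; rewrite mulrC; split=> //.
  have [_ _] := @ideal_gen_ideal _ _ [set h]; apply.
  exact: sub_gen_smallest.
have sub_cap (h : {mpoly R[i][N]}) (k : M) :
    D0degI d k I `<=` D0degI d k (I `&` ideal_gen [set h]).
  by move=> D [D_deg D_I]; split=> //; apply: (D0I_sub _ D_I) => f [].
(* The extension statement for a family with one member. *)
have colon_Phi (h : {mpoly R[i][N]}) (k : M) : Rdeg R[i] d k h ->
    D0degI d m (colon1 I h) `<=` Phi h @` D0degI d (m + k) I.
  move=> hk D [D_deg [_ D_vanish]].
  have [||D' [D'I ->]] := @Phi_lift _ _ _ _ _ s_uniq mem_s I m 1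
    (fun=> h) (fun=> k) D hI _ D_deg.
  - by [].
  - by move=> f If; apply: D_vanish; exact: If ord0.
  by exists (D' ord0); rewrite ?big_ord1.
have Phi_I (h : {mpoly R[i][N]}) (k : M) : Rdeg R[i] d k h ->
    Phi h @` D0degI d (m + k) I = D0degI d m (colon1 I h).
  move=> hk; apply/seteqP; split=> [_ [D DI <-]|]; last exact: colon_Phi.
  by apply: (Phi_colon _ _ _ hk); exact: sub_cap.
(* This image lies between [Phi h @] of the smaller space [D0degI d (m + k) I] and the colon space,
   which agree by [Phi_I]. *)
have Phi_cap (h : {mpoly R[i][N]}) (k : M) : Rdeg R[i] d k h ->
    Phi h @` D0degI d (m + k) (I `&` ideal_gen [set h])
      = D0degI d m (colon1 I h).
  move=> hk; apply/seteqP; split=> [_ [D DI <-]|]; first exact: Phi_colon hk DI.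
  by rewrite -(Phi_I _ _ hk); apply: image_subset; exact: sub_cap.
split; rewrite ?(Phi_I _ _ hg) ?(Phi_cap _ _ hg) //.
  by congr sum_sub; apply/funext => i; rewrite (Phi_I _ _ (hgs i)).
rewrite hJgs colon_gen //; apply/seteqP; split=> [_ [u u_colon ->]|D].
  apply: (D0degI_sum s_uniq mem_s) => i; have [u_deg u_I] := u_colon i.
  by split=> //; apply: (D0I_sub _ u_I) => f; apply.
(* [D] vanishes on the intersection of the [I : gs i], so it lifts along all [gs i] jointly; [Phi_I]
   then places each summand in its own colon space. *)
move=> [D_deg [_ D_vanish]].
have [//|D' [D'I ->]] := Phi_lift s_uniq mem_s hI hgs D_deg.
exists (fun i => Phi (gs i) (D' i)) => // i.
by rewrite -(Phi_I _ _ (hgs i)); exists (D' i).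
Qed.
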